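(* Let $w_\epsilon(r,t)=r^{\sigma(\epsilon)}\phi(t,\epsilon)+\overline{r^{\sigma(\epsilon)}\psi(t,\epsilon)}$ be a family of basic solutions of $\mathcal{L}_\epsilon$, depending continuously on $\epsilon\in\mathbb{R}$, with $\mathrm{Char}(w_\epsilon)=(\sigma(\epsilon),j)$. Then for every $\epsilon$ the operator $\mathcal{L}_\epsilon^*$ has a basic solution \[ w^\star_\epsilon(r,t)=r^{-\sigma(\epsilon)}X(t,\epsilon)+\overline{r^{-\sigma(\epsilon)}Z(t,\epsilon)} \] with $|X|>|Z|$ and $\mathrm{Char}(w^\star_\epsilon)=(-\sigma(\epsilon),-j)$.
   Context: Fix $a>0$, $b\in\mathbb{R}\setminus\{0\}$, $\nu\in[0,1)$, an integer $k\ge 2$ and $c\in C^k(\mathbb{S}^1,\mathbb{C})$ (functions on $\mathbb{S}^1$ are $2\pi$-periodic functions of $t\in\mathbb{R}$). For $\epsilon\in\mathbb{R}$ put $\lambda_\epsilon=a+ib\epsilon$, $L_\epsilon=\lambda_\epsilon\partial_t-ir\partial_r$ on $(0,\infty)\times\mathbb{S}^1$, $\mathcal{L}_\epsilon u=L_\epsilon u+i\lambda_\epsilon\nu u-c(t)\bar u$ and $\mathcal{L}^*_\epsilon v=-\big(L_\epsilon v-i\lambda_\epsilon\nu v+\overline{c(t)}\,\bar v\big)$. A basic solution of $\mathcal{L}_\epsilon$ (resp. $\mathcal{L}^*_\epsilon$) is a nontrivial solution $w$ of $\mathcal{L}_\epsilon w=0$ (resp. $\mathcal{L}^*_\epsilon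 w=0$) on $(0,\infty)\times\mathbb{S}^1$ of the form $w=r^\sigma\phi(t)+\overline{r^\sigma\psi(t)}$ with $\sigma\in\mathbb{C}$, $\phi,\psi$ $2\pi$-periodic. Such $w$ can be written with $|\phi|>|\psi|$ everywhere when $\sigma\notin\mathbb{R}$ (replacing $(\sigma,\phi,\psi)$ by $(\bar\sigma,\bar\psi,\bar\phi)$ if necessary), and as $w=r^\sigma f$ with $f$ nowhere zero when $\sigma\in\mathbb{R}$; the exponent of $w$ is this $\sigma$, its winding number $\mathrm{Ind}(w)$ is the winding number about $0$ of $\phi$ (resp. $f$), and $\mathrm{Char}(w)=(\sigma,\mathrm{Ind}(w))$. *)

(* Defs.v *)
From Stdlib Require Import Reals ZArith.
Open Scope R_scope.

Definition Cplx : Type := (R * R)%type.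
Definition Cre (z : Cplx) : R := fst z.
Definition Cim (z : Cplx) : R := snd z.
Definition C0 : Cplx := (0, 0).
Definition Ci : Cplx := (0, 1).
Definition RtoC (x : R) : Cplx := (x, 0).
Definition Cadd (z w : Cplx) : Cplx := (Cre z + Cre w, Cim z + Cim w).
Definition Copp (z : Cplx) : Cplx := (- Cre z, - Cim z).
Definition Csub (z w : Cplx) : Cplx := Cadd z (Copp w).
Definition Cmul (z w : Cplx) : Cplx :=
  (Cre z * Cre w - Cim z * Cim w, Cre z * Cim w + Cim z * Cre w).
Definition Cconj (z : Cplx) : Cplx := (Cre z, - Cim z).
Definition Cnorm (z : Cplx) : R := sqrt (Cre z * Cre z + Cim z * Cim z).

Definition Cexp (z : Cplx) : Cplx := (exp (Cre z) * cos (Cim z), exp (Cre z) * sin (Cim z)).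
Definition Cpow (r : R) (s : Cplx) : Cplx := Cexp (Cmul s (RtoC (ln r))).

Definition Ccont (f : R -> Cplx) : Prop :=
  continuity (fun x => Cre (f x)) /\ continuity (fun x => Cim (f x)).

Definition Cderiv_lim (f : R -> Cplx) (x : R) (l : Cplx) : Prop :=
  derivable_pt_lim (fun y => Cre (f y)) x (Cre l) /\
  derivable_pt_lim (fun y => Cim (f y)) x (Cim l).

Fixpoint Cn_real (n : nat) (f : R -> R) : Prop :=
  match n with
  | O => continuity f
  | S m => exists f' : R -> R, (forall x, derivable_pt_lim f x (f' x)) /\ Cn_real m f'
  end.

Definition Cn_cplx (n : nat) (f : R -> Cplx) : Prop :=
  Cn_real n (fun x => Cre (f x)) /\ Cn_real n (fun x => Cim (f x)).

(** 2pi-periodic functions = functions on S^1 *)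
Definition periodic (f : R -> Cplx) : Prop := forall t, f (t + 2 * PI) = f t.

Definition Ccont2 (f : R -> R -> Cplx) : Prop :=
  forall t e eta, 0 < eta -> exists delta, 0 < delta /\
    forall t' e', Rabs (t' - t) < delta -> Rabs (e' - e) < delta ->
      Cnorm (Csub (f t' e') (f t e)) < eta.

Definition Ccont_fun (s : R -> Cplx) : Prop :=
  continuity (fun e => Cre (s e)) /\ continuity (fun e => Cim (s e)).

Definition winding (f : R -> Cplx) (k : Z) : Prop :=
  Ccont f /\ periodic f /\ (forall t, f t <> C0) /\
  exists theta : R -> R, continuity theta /\
    (forall t, f t = (Cnorm (f t) * cos (theta t), Cnorm (f t) * sin (theta t))) /\
    theta (2 * PI) - theta 0 = 2 * PI * IZR k.

(** * The operators.  Functions on (0,oo) x S^1 are w : R -> R -> Cplx, w r t. *)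
Definition lam (a b eps : R) : Cplx := (a, b * eps).

Definition partials (w : R -> R -> Cplx) (r t : R) (wr wt : Cplx) : Prop :=
  Cderiv_lim (fun r' => w r' t) r wr /\ Cderiv_lim (fun t' => w r t') t wt.

Definition solves_L (a b nu : R) (c : R -> Cplx) (eps : R) (w : R -> R -> Cplx) : Prop :=
  forall r t, 0 < r -> exists wr wt, partials w r t wr wt /\
    Cadd (Cadd (Csub (Cmul (lam a b eps) wt) (Cmul Ci (Cmul (RtoC r) wr)))
               (Cmul Ci (Cmul (lam a b eps) (Cmul (RtoC nu) (w r t)))))
         (Copp (Cmul (c t) (Cconj (w r t)))) = C0.

Definition solves_Lstar (a b nu : R) (c : R -> Cplx) (eps : R) (w : R -> R -> Cplx) : Prop :=
  forall r t, 0 < r -> exists wr wt, partials w r t wr wt /\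
    Copp (Cadd (Csub (Csub (Cmul (lam a b eps) wt) (Cmul Ci (Cmul (RtoC r) wr)))
                     (Cmul Ci (Cmul (lam a b eps) (Cmul (RtoC nu) (w r t)))))
               (Cmul (Cconj (c t)) (Cconj (w r t)))) = C0.

Definition basic_form (w : R -> R -> Cplx) (s : Cplx) (phi psi : R -> Cplx) : Prop :=
  periodic phi /\ periodic psi /\
  forall r t, 0 < r -> w r t = Cadd (Cmul (Cpow r s) (phi t)) (Cconj (Cmul (Cpow r s) (psi t))).

Definition nontrivial (w : R -> R -> Cplx) : Prop := exists r t, 0 < r /\ w r t <> C0.

Definition basic_sol_L a b nu c eps (w : R -> R -> Cplx) : Prop :=
  nontrivial w /\ solves_L a b nu c eps w /\ exists s phi psi, basic_form w s phi psi.

Definition basic_sol_Lstar a b nu c eps (w : R -> R -> Cplx) : Prop :=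
  nontrivial w /\ solves_Lstar a b nu c eps w /\ exists s phi psi, basic_form w s phi psi.

Definition has_char (w : R -> R -> Cplx) (s : Cplx) (k : Z) : Prop :=
  (Cim s <> 0 /\ exists phi psi, basic_form w s phi psi /\
      (forall t, Cnorm (psi t) < Cnorm (phi t)) /\ winding phi k)
  \/
  (Cim s = 0 /\ exists f, periodic f /\ (forall t, f t <> C0) /\
      (forall r t, 0 < r -> w r t = Cmul (Cpow r s) (f t)) /\ winding f k).

(* Main.v *)
(** Separating the powers of [r], a function [r^s phi + conj (r^s psi)] with [s] not real solves
    [L_eps] iff [(phi, psi)] solves a [2 x 2] linear system with matrix
    [M = ((A, B), (conj B, D))], [A = i (s / lambda - nu)], [D = - i (s / conj lambda - nu)],
    [B = c / lambda]; the adjoint equation for [r^(-s) X + conj (r^(-s) Z)] becomes the dual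
    system [- M^T] for [(p, q) = (X, (conj lambda / lambda) Z)], so [phi p + psi q] is constant.
    Reduction of order produces a periodic dual solution with [phi p + psi q = 1].
    The equation [(|phi|^2 - |psi|^2)' = 2 Re A |phi|^2 - 2 Re D |psi|^2] shows that the sign of
    [|phi|^2 - |psi|^2] for a periodic solution depends only on [A] and [D], through a quantity
    that is invariant under [(A, D) -> (- A, - D)]; hence [|p| > |q|], and then
    [|phi p| > |1 - phi p|] confines [phi p] to a half plane, which gives [Ind p = - Ind phi].
    When [s] is real, [psi] is [conj phi] and one uses the solution [p + conj q] of the dual
    equation, or [i conj phi] if [Re A = 0]. *)

From Stdlib Require Import Reals ZArith Lra.
From Coquelicot Require Import Coquelicot.
Require Import Defs.
Open Scope R_scope.
Set Bullet Behavior "Strict Subproofs".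

(** * The complex field, conjugation and modulus *)

Definition C1 : Cplx := (1, 0).
Definition Cinv (z : Cplx) : Cplx :=
  (Cre z / (Cre z * Cre z + Cim z * Cim z), - Cim z / (Cre z * Cre z + Cim z * Cim z)).
Definition Cdiv (z w : Cplx) : Cplx := Cmul z (Cinv w).

Declare Scope cplx_scope.
Delimit Scope cplx_scope with K.
Bind Scope cplx_scope with Cplx.
Infix "+" := Cadd : cplx_scope.
Infix "-" := Csub : cplx_scope.
Infix "*" := Cmul : cplx_scope.
Infix "/" := Cdiv : cplx_scope.
Notation "- x" := (Copp x) : cplx_scope.

Lemma Cplx_eq (z w : Cplx) : Cre z = Cre w -> Cim z = Cim w -> z = w.
Proof. destruct z, w; simpl; congruence. Qed.

Ltac cplx :=
  unfold Cdiv, Csub, Cadd, Copp, Cmul, Cconj, C0, C1, Ci, RtoC in *; simpl in *.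

Lemma Cnsq_pos (z : Cplx) : z <> C0 -> 0 < Cre z * Cre z + Cim z * Cim z.
Proof.
  intros Hz.
  destruct (Req_dec (Cre z) 0) as [H1|H1].
  - destruct (Req_dec (Cim z) 0) as [H2|H2].
    + exfalso; apply Hz; apply Cplx_eq; assumption.
    + nra.
  - nra.
Qed.

Lemma Cplx_ring_theory : ring_theory C0 C1 Cadd Cmul Csub Copp eq.
Proof. constructor; intros; apply Cplx_eq; cplx; ring. Qed.

Lemma Cplx_field_theory : field_theory C0 C1 Cadd Cmul Csub Copp Cdiv Cinv eq.
Proof.
  constructor.
  - exact Cplx_ring_theory.
  - intros H; injection H; lra.
  - reflexivity.
  - intros z Hz. pose proof (Cnsq_pos z Hz) as Hp.
    apply Cplx_eq; cplx; field; lra.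
Qed.

Add Field Cplx_field : Cplx_field_theory.

Lemma Cconj_add (z w : Cplx) : Cconj (z + w)%K = (Cconj z + Cconj w)%K.
Proof. apply Cplx_eq; cplx; ring. Qed.

Lemma Cconj_opp (z : Cplx) : Cconj (- z)%K = (- Cconj z)%K.
Proof. apply Cplx_eq; cplx; ring. Qed.

Lemma Cconj_sub (z w : Cplx) : Cconj (z - w)%K = (Cconj z - Cconj w)%K.
Proof. apply Cplx_eq; cplx; ring. Qed.

Lemma Cconj_mul (z w : Cplx) : Cconj (z * w)%K = (Cconj z * Cconj w)%K.
Proof. apply Cplx_eq; cplx; ring. Qed.

Lemma Cconj_inv (z : Cplx) : Cconj (Cinv z) = Cinv (Cconj z).
Proof. apply Cplx_eq; unfold Cinv; cplx; unfold Rdiv; rewrite Rmult_opp_opp; ring. Qed.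

Lemma Cconj_div (z w : Cplx) : Cconj (z / w)%K = (Cconj z / Cconj w)%K.
Proof. unfold Cdiv; rewrite Cconj_mul, Cconj_inv; reflexivity. Qed.

Lemma Cconj_conj (z : Cplx) : Cconj (Cconj z) = z.
Proof. apply Cplx_eq; cplx; ring. Qed.

Lemma Cconj_RtoC (x : R) : Cconj (RtoC x) = RtoC x.
Proof. apply Cplx_eq; cplx; ring. Qed.

Lemma Cconj_Ci : Cconj Ci = (- Ci)%K.
Proof. apply Cplx_eq; cplx; ring. Qed.

Lemma Cconj_C0 : Cconj C0 = C0.
Proof. apply Cplx_eq; cplx; ring. Qed.

Lemma Cconj_neq0 (z : Cplx) : z <> C0 -> Cconj z <> C0.
Proof.
  intros Hz H; apply Hz; rewrite <- (Cconj_conj z), H; exact Cconj_C0.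
Qed.

#[local] Hint Rewrite Cconj_add Cconj_opp Cconj_sub Cconj_mul Cconj_div Cconj_conj Cconj_RtoC
  Cconj_Ci Cconj_C0 : conj.

Lemma Cmul_neq0 (z w : Cplx) : z <> C0 -> w <> C0 -> (z * w)%K <> C0.
Proof.
  intros Hz Hw H; apply Hw.
  replace w with ((z * w) / z)%K by (field; exact Hz).
  rewrite H; field; exact Hz.
Qed.

Lemma Cnorm_lt_iff (z w : Cplx) :
  Cnorm z < Cnorm w <-> Cre z * Cre z + Cim z * Cim z < Cre w * Cre w + Cim w * Cim w.
Proof.
  unfold Cnorm; split; intros H.
  - apply sqrt_lt_0_alt; exact H.
  - apply sqrt_lt_1_alt; split; [nra | exact H].
Qed.

Lemma Cnorm_lt_neq0 (z w : Cplx) : Cnorm z < Cnorm w -> w <> C0.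
Proof.
  intros H ->; apply Cnorm_lt_iff in H; cplx; nra.
Qed.

Lemma Cnorm_C0_lt (z : Cplx) : z <> C0 -> Cnorm C0 < Cnorm z.
Proof. intros Hz; apply Cnorm_lt_iff; pose proof (Cnsq_pos z Hz); cplx; lra. Qed.

Lemma Cnorm_pos (z : Cplx) : z <> C0 -> 0 < Cnorm z.
Proof. intros Hz; apply sqrt_lt_R0, Cnsq_pos, Hz. Qed.

(** * Complex exponential and powers of a positive real *)

Lemma Cexp_add (z w : Cplx) : Cexp (z + w)%K = (Cexp z * Cexp w)%K.
Proof.
  apply Cplx_eq; unfold Cexp; cplx; rewrite exp_plus; [rewrite cos_plus | rewrite sin_plus]; ring.
Qed.

Lemma Cexp_C0 : Cexp C0 = C1.
Proof. apply Cplx_eq; unfold Cexp; cplx; rewrite exp_0; [rewrite cos_0 | rewrite sin_0]; ring. Qed.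

Lemma Cexp_neq0 (z : Cplx) : Cexp z <> C0.
Proof.
  intros H. assert (E : (Cexp z * Cexp (- z))%K = C1).
  { rewrite <- Cexp_add, <- Cexp_C0; f_equal; ring. }
  rewrite H in E; apply (F_1_neq_0 Cplx_field_theory); rewrite <- E; ring.
Qed.

Lemma Cpow_1 (s : Cplx) : Cpow 1 s = C1.
Proof.
  unfold Cpow; rewrite ln_1, <- Cexp_C0; f_equal; apply Cplx_eq; cplx; ring.
Qed.

Lemma Cpow_real (r : R) (s : Cplx) : Cim s = 0 -> Cconj (Cpow r s) = Cpow r s.
Proof.
  intros Hs; apply Cplx_eq; [reflexivity|].
  unfold Cpow, Cexp; cplx; rewrite Hs.
  replace (Cre s * 0 + 0 * ln r) with 0 by ring; rewrite sin_0; ring.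
Qed.

(** * Differential calculus for complex-valued functions of a real variable *)

Lemma derivable_pt_lim_eq (f : R -> R) (x l l' : R) :
  derivable_pt_lim f x l -> l = l' -> derivable_pt_lim f x l'.
Proof. intros H <-; exact H. Qed.

Lemma Cderiv_eq (f : R -> Cplx) (x : R) (l l' : Cplx) :
  Cderiv_lim f x l -> l = l' -> Cderiv_lim f x l'.
Proof. intros H <-; exact H. Qed.

Lemma Cderiv_ext (f g : R -> Cplx) (x : R) (l : Cplx) :
  (forall y, f y = g y) -> Cderiv_lim f x l -> Cderiv_lim g x l.
Proof.
  intros E [H1 H2]; split; apply is_derive_Reals.
  - apply (is_derive_ext (fun y => Cre (f y))); [intros; rewrite E; reflexivity|].
    apply is_derive_Reals, H1.
  - apply (is_derive_ext (fun y => Cim (f y))); [intros; rewrite E; reflexivity|].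
    apply is_derive_Reals, H2.
Qed.

Lemma Cderiv_unique (f : R -> Cplx) (x : R) (l m : Cplx) :
  Cderiv_lim f x l -> Cderiv_lim f x m -> l = m.
Proof.
  intros [H1 H2] [H3 H4]; apply Cplx_eq; eapply uniqueness_limite; eassumption.
Qed.

Lemma Cderiv_const (z : Cplx) (x : R) : Cderiv_lim (fun _ => z) x C0.
Proof. split; apply derivable_pt_lim_const. Qed.

Lemma Cderiv_add (f g : R -> Cplx) (x : R) (l m : Cplx) :
  Cderiv_lim f x l -> Cderiv_lim g x m -> Cderiv_lim (fun y => f y + g y)%K x (l + m)%K.
Proof.
  intros [H1 H2] [H3 H4]; split.
  - exact (derivable_pt_lim_plus _ _ _ _ _ H1 H3).
  - exact (derivable_pt_lim_plus _ _ _ _ _ H2 H4).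
Qed.

Lemma Cderiv_opp (f : R -> Cplx) (x : R) (l : Cplx) :
  Cderiv_lim f x l -> Cderiv_lim (fun y => - f y)%K x (- l)%K.
Proof.
  intros [H1 H2]; split.
  - exact (derivable_pt_lim_opp _ _ _ H1).
  - exact (derivable_pt_lim_opp _ _ _ H2).
Qed.

Lemma Cderiv_sub (f g : R -> Cplx) (x : R) (l m : Cplx) :
  Cderiv_lim f x l -> Cderiv_lim g x m -> Cderiv_lim (fun y => f y - g y)%K x (l - m)%K.
Proof. intros H1 H2; apply Cderiv_add; [exact H1 | apply Cderiv_opp, H2]. Qed.

Lemma Cderiv_conj (f : R -> Cplx) (x : R) (l : Cplx) :
  Cderiv_lim f x l -> Cderiv_lim (fun y => Cconj (f y)) x (Cconj l).
Proof.
  intros [H1 H2]; split; [exact H1 | exact (derivable_pt_lim_opp _ _ _ H2)].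
Qed.

Lemma Cderiv_mul (f g : R -> Cplx) (x : R) (l m : Cplx) :
  Cderiv_lim f x l -> Cderiv_lim g x m ->
  Cderiv_lim (fun y => f y * g y)%K x (l * g x + f x * m)%K.
Proof.
  intros [H1 H2] [H3 H4]; split.
  - eapply derivable_pt_lim_eq.
    + exact (derivable_pt_lim_minus _ _ _ _ _ (derivable_pt_lim_mult _ _ _ _ _ H1 H3)
               (derivable_pt_lim_mult _ _ _ _ _ H2 H4)).
    + cplx; ring.
  - eapply derivable_pt_lim_eq.
    + exact (derivable_pt_lim_plus _ _ _ _ _ (derivable_pt_lim_mult _ _ _ _ _ H1 H4)
               (derivable_pt_lim_mult _ _ _ _ _ H2 H3)).
    + cplx; ring.
Qed.

Lemma Cderiv_scal (z : Cplx) (f : R -> Cplx) (x : R) (l : Cplx) :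
  Cderiv_lim f x l -> Cderiv_lim (fun y => z * f y)%K x (z * l)%K.
Proof.
  intros H; eapply Cderiv_eq; [exact (Cderiv_mul _ _ _ _ _ (Cderiv_const z x) H) | cbv beta; ring].
Qed.

Lemma Cderiv_inv (f : R -> Cplx) (x : R) (l : Cplx) :
  f x <> C0 -> Cderiv_lim f x l ->
  Cderiv_lim (fun y => Cinv (f y)) x (- (l / (f x * f x)))%K.
Proof.
  intros Hx [H1 H2]. pose proof (Cnsq_pos _ Hx) as Hp.
  assert (Hn := derivable_pt_lim_plus _ _ _ _ _ (derivable_pt_lim_mult _ _ _ _ _ H1 H1)
                  (derivable_pt_lim_mult _ _ _ _ _ H2 H2)).
  assert (Hn0 : ((fun y => Cre (f y)) * (fun y => Cre (f y)) +
                 (fun y => Cim (f y)) * (fun y => Cim (f y)))%F x <> 0)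
    by (unfold plus_fct, mult_fct; lra).
  (* This is the squared modulus of [f x * f x], the denominator that comes from the inverse of that
     square; [field] needs it nonzero. *)
  assert (Hp' : (Cre (f x) * Cre (f x) - Cim (f x) * Cim (f x)) *
                (Cre (f x) * Cre (f x) - Cim (f x) * Cim (f x)) +
                (Cre (f x) * Cim (f x) + Cim (f x) * Cre (f x)) *
                (Cre (f x) * Cim (f x) + Cim (f x) * Cre (f x)) <> 0).
  { replace (_ + _) with ((Cre (f x) * Cre (f x) + Cim (f x) * Cim (f x)) *
                          (Cre (f x) * Cre (f x) + Cim (f x) * Cim (f x))) by ring.
    nra. }
  split.
  - eapply derivable_pt_lim_eq.
    + exact (derivable_pt_lim_div _ _ _ _ _ H1 Hn Hn0).
    + unfold Rsqr, plus_fct, mult_fct, Cinv; cplx; field; split; [exact Hp' | lra].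
  - eapply derivable_pt_lim_eq.
    + exact (derivable_pt_lim_div _ _ _ _ _ (derivable_pt_lim_opp _ _ _ H2) Hn Hn0).
    + unfold Rsqr, plus_fct, mult_fct, opp_fct, Cinv; cplx; field; split; [exact Hp' | lra].
Qed.

Lemma Cderiv_div (f g : R -> Cplx) (x : R) (l m : Cplx) :
  g x <> C0 -> Cderiv_lim f x l -> Cderiv_lim g x m ->
  Cderiv_lim (fun y => f y / g y)%K x ((l * g x - f x * m) / (g x * g x))%K.
Proof.
  intros H0 Hf Hg; eapply Cderiv_eq.
  - exact (Cderiv_mul _ _ _ _ _ Hf (Cderiv_inv _ _ _ H0 Hg)).
  - cbv beta; unfold Cdiv; field; exact H0.
Qed.

Lemma Cderiv_exp (f : R -> Cplx) (x : R) (l : Cplx) :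
  Cderiv_lim f x l -> Cderiv_lim (fun y => Cexp (f y)) x (l * Cexp (f x))%K.
Proof.
  intros [H1 H2].
  assert (He := derivable_pt_lim_comp _ _ _ _ _ H1 (derivable_pt_lim_exp (Cre (f x)))).
  assert (Hc := derivable_pt_lim_comp _ _ _ _ _ H2 (derivable_pt_lim_cos (Cim (f x)))).
  assert (Hs := derivable_pt_lim_comp _ _ _ _ _ H2 (derivable_pt_lim_sin (Cim (f x)))).
  split.
  - eapply derivable_pt_lim_eq; [exact (derivable_pt_lim_mult _ _ _ _ _ He Hc)|].
    unfold comp, Cexp; cplx; ring.
  - eapply derivable_pt_lim_eq; [exact (derivable_pt_lim_mult _ _ _ _ _ He Hs)|].
    unfold comp, Cexp; cplx; ring.
Qed.

Lemma Cderiv_exp_line (z : Cplx) (x : R) :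
  Cderiv_lim (fun t => Cexp (RtoC t * z)%K) x (z * Cexp (RtoC x * z))%K.
Proof.
  apply (Cderiv_exp (fun t => RtoC t * z)%K).
  eapply Cderiv_eq.
  - apply (Cderiv_mul RtoC (fun _ => z) x C1 C0); [|apply Cderiv_const].
    split; [apply derivable_pt_lim_id | apply derivable_pt_lim_const].
  - ring.
Qed.

Lemma Cderiv_Cpow (s : Cplx) (r : R) :
  0 < r -> Cderiv_lim (fun y => Cpow y s) r (s * RtoC (/ r) * Cpow r s)%K.
Proof.
  intros Hr; unfold Cpow.
  apply (Cderiv_exp (fun y => s * RtoC (ln y))%K), Cderiv_scal.
  split; [exact (derivable_pt_lim_ln r Hr) | apply derivable_pt_lim_const].
Qed.

Lemma Cderiv_cont (f f' : R -> Cplx) : (forall t, Cderiv_lim f t (f' t)) -> Ccont f.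
Proof.
  intros H; split; intros t; apply derivable_continuous_pt.
  - exists (Cre (f' t)); apply H.
  - exists (Cim (f' t)); apply H.
Qed.

Lemma Ccont_mul (f g : R -> Cplx) : Ccont f -> Ccont g -> Ccont (fun t => f t * g t)%K.
Proof.
  intros [H1 H2] [H3 H4]; split.
  - exact (continuity_minus _ _ (continuity_mult _ _ H1 H3) (continuity_mult _ _ H2 H4)).
  - exact (continuity_plus _ _ (continuity_mult _ _ H1 H4) (continuity_mult _ _ H2 H3)).
Qed.

Lemma Ccont_const (z : Cplx) : Ccont (fun _ => z).
Proof. split; apply continuity_const; intros x y; reflexivity. Qed.

Lemma Cderiv_zero_const (f : R -> Cplx) (x y : R) :
  (forall t, Cderiv_lim f t C0) -> f x = f y.
Proof.
  intros H.
  assert (G : forall u v, u < v -> f u = f v).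
  { intros u v Huv; apply Cplx_eq.
    - apply (eq_is_derive (fun t => Cre (f t)) u v); [|exact Huv].
      intros t _; apply is_derive_Reals, (proj1 (H t)).
    - apply (eq_is_derive (fun t => Cim (f t)) u v); [|exact Huv].
      intros t _; apply is_derive_Reals, (proj2 (H t)). }
  destruct (Rtotal_order x y) as [L|[->|L]]; [apply G, L | reflexivity | symmetry; apply G, L].
Qed.

(** * Primitives, and primitives with a prescribed multiplier over a period *)

Lemma continuity_primitive (h : R -> R) :
  continuity h -> exists u, forall t, derivable_pt_lim u t (h t).
Proof.
  intros Hh; exists (fun t => RInt h 0 t); intros t.
  assert (Hc : forall x, continuous h x) by (intros x; apply continuity_pt_filterlim, Hh).
  apply is_derive_Reals, (is_derive_RInt h _ 0 t); [|apply Hc].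
  apply filter_forall; intros x.
  apply (@RInt_correct R_CompleteNormedModule h 0 x).
  apply (@ex_RInt_continuous R_CompleteNormedModule).
  intros z _; apply Hc.
Qed.

Lemma Ccont_primitive (h : R -> Cplx) :
  Ccont h -> exists u, forall t, Cderiv_lim u t (h t).
Proof.
  intros [H1 H2].
  destruct (continuity_primitive _ H1) as [u Hu], (continuity_primitive _ H2) as [v Hv].
  exists (fun t => (u t, v t)); intros t; split; [apply Hu | apply Hv].
Qed.

(** For any primitive [U] of [h], the defect [U (t + L) - m * U t] has zero derivative, hence is
    constant. A constant added to [U] changes the defect by that constant times [1 - m], so the
    defect can be cancelled when [m] is not 1. *)
Lemma twisted_primitive (h : R -> Cplx) (L : R) (m : Cplx) :
  Ccont h -> (forall t, h (t + L) = (m * h t)%K) -> m <> C1 ->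
  exists u, (forall t, Cderiv_lim u t (h t)) /\ forall t, u (t + L) = (m * u t)%K.
Proof.
  intros Hc Hm Hm1.
  destruct (Ccont_primitive h Hc) as [U HU].
  assert (Hd : (C1 - m)%K <> C0).
  { intros H; apply Hm1; replace m with (C1 - (C1 - m))%K by ring; rewrite H; ring. }
  (* The unique solution of [U L + z = m * (U 0 + z)], the twisted relation at time 0. *)
  set (z := ((m * U 0%R - U L) / (C1 - m))%K).
  exists (fun t => U t + z)%K; split.
  - intros t; eapply Cderiv_eq; [exact (Cderiv_add _ _ _ _ _ (HU t) (Cderiv_const z t)) | cbv beta; ring].
  - intros t.
    assert (HL : forall t, Cderiv_lim (fun t => U (t + L)) t (h (t + L))).
    { intros s; destruct (HU (s + L)) as [H1 H2].
      assert (Hs : derivable_pt_lim (fun t => t + L) s 1).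
      { eapply derivable_pt_lim_eq; [exact (derivable_pt_lim_plus _ _ _ _ _
          (derivable_pt_lim_id s) (derivable_pt_lim_const L s)) | cbv beta; ring]. }
      split; eapply derivable_pt_lim_eq.
      - exact (derivable_pt_lim_comp _ _ _ _ _ Hs H1).
      - ring.
      - exact (derivable_pt_lim_comp _ _ _ _ _ Hs H2).
      - ring. }
    assert (E : (U (t + L)%R - m * U t = U (0 + L)%R - m * U 0%R)%K).
    { apply (Cderiv_zero_const (fun t => U (t + L)%R - m * U t)%K); intros s.
      eapply Cderiv_eq; [exact (Cderiv_sub _ _ _ _ _ (HL s) (Cderiv_scal m _ _ _ (HU s)))|].
      rewrite Hm; ring. }
    rewrite Rplus_0_l in E.
    replace (U (t + L)) with ((U (t + L)%R - m * U t) + m * U t)%K by ring.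
    rewrite E; unfold z; field; exact Hd.
Qed.

(** * Periodic linear 2 x 2 systems and their duals *)

(** The diagonal entries are constant and only the off-diagonal ones vary with time. Passing to
    minus the transpose therefore negates all entries and swaps [B] with [C]. *)
Definition linear_system (A D : Cplx) (B C phi psi : R -> Cplx) : Prop :=
  forall t, Cderiv_lim phi t (A * phi t + B t * psi t)%K /\
            Cderiv_lim psi t (C t * phi t + D * psi t)%K.

(* Reduction of order: the normalisation [phi p + psi q = 1] eliminates [p], and
   [q = exp (- T t) phi u] turns the equation for [q] into [u' = - B exp (T t) / phi^2]. *)
Lemma adjoint_periodic_solution (A D : Cplx) (B C phi psi : R -> Cplx) :
  Ccont B -> periodic B -> periodic phi -> periodic psi -> (forall t, phi t <> C0) ->
  linear_system A D B C phi psi -> Cexp (RtoC (2 * PI) * (A + D))%K <> C1 ->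
  exists p q, periodic p /\ periodic q /\
    linear_system (- A)%K (- D)%K (fun t => - C t)%K (fun t => - B t)%K p q /\
    forall t, (phi t * p t + psi t * q t)%K = C1.
Proof.
  intros HB HBper Hphi Hpsi Hphi0 Hsys HT.
  set (T := (A + D)%K) in *.
  pose (ep := fun t => Cexp (RtoC t * T)%K).
  assert (Hep0 : forall t, ep t <> C0) by (intros t; apply Cexp_neq0).
  assert (HepL : forall t, ep (t + 2 * PI) = (Cexp (RtoC (2 * PI) * T) * ep t)%K).
  { intros t; unfold ep; rewrite <- Cexp_add; f_equal; apply Cplx_eq; cplx; ring. }
  assert (Hep : forall t, Cderiv_lim ep t (T * ep t)%K) by (intros t; apply Cderiv_exp_line).
  pose (h := fun t => (- C1 * B t * (ep t / (phi t * phi t)))%K).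
  (* [h] and [ep] share the multiplier [exp (2 pi T)]. Asking the same of [u] makes the quotient
     [phi u / ep] periodic. *)
  destruct (twisted_primitive h (2 * PI) (Cexp (RtoC (2 * PI) * T)%K)) as [u [Hu HuL]].
  - unfold h; repeat apply Ccont_mul; try apply Ccont_const; try exact HB.
    + apply (Cderiv_cont _ _ Hep).
    + eapply Cderiv_cont; intros t; apply Cderiv_inv.
      * apply Cmul_neq0; apply Hphi0.
      * apply Cderiv_mul; apply Hsys.
  - intros t; unfold h; rewrite HBper, HepL, Hphi; unfold Cdiv; ring.
  - exact HT.
  - pose (q := fun t => (phi t * u t / ep t)%K).
    pose (p := fun t => ((C1 - psi t * q t) / phi t)%K).
    assert (Hq : forall t, Cderiv_lim q t (- B t * p t + - D * q t)%K).
    { intros t; eapply Cderiv_eq.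
      - apply Cderiv_div; [apply Hep0 | apply Cderiv_mul; [apply Hsys | apply Hu] | apply Hep].
      - unfold p, q, h, T; field; split; [apply Hep0 | apply Hphi0]. }
    assert (Hp : forall t, Cderiv_lim p t (- A * p t + - C t * q t)%K).
    { intros t; eapply Cderiv_eq.
      - apply Cderiv_div; [apply Hphi0 | | apply Hsys].
        apply Cderiv_sub; [apply Cderiv_const | apply Cderiv_mul; [apply Hsys | apply Hq]].
      - cbv beta; unfold p; field; apply Hphi0. }
    exists p, q; repeat split; try apply Hp; try apply Hq.
    + intros t; unfold p, q; rewrite Hpsi, Hphi, HuL, HepL; field; repeat split;
        first [apply Hphi0 | apply Hep0 | apply Cexp_neq0].
    + intros t; unfold q; rewrite Hphi, HuL, HepL; field; split;
        first [apply Hep0 | apply Cexp_neq0].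
    + intros t; unfold p; field; apply Hphi0.
Qed.

(* [exp (- kappa t) E t] is strictly monotone, which fixes the sign of its increment over a
   period, a multiple of [E t]. *)
Lemma periodic_linear_sign (E g : R -> R) (kappa d L : R) :
  0 < L -> d <> 0 -> (forall t, 0 < g t) -> (forall t, E (t + L) = E t) ->
  (forall t, derivable_pt_lim E t (kappa * E t + d * g t)) ->
  forall t, 0 < - (kappa * d * E t).
Proof.
  intros HL Hd Hg Hper HE t.
  assert (HG : forall s, derivable_pt_lim (fun s => exp (- kappa * s) * E s) s
                           (exp (- kappa * s) * (d * g s))).
  { intros s; eapply derivable_pt_lim_eq.
    - assert (H1 : derivable_pt_lim (fun s => exp (- kappa * s)) s
                     (exp (- kappa * s) * (- kappa * 1))).
      { exact (derivable_pt_lim_comp _ _ _ _ _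
                 (derivable_pt_lim_scal _ (- kappa) _ _ (derivable_pt_lim_id s))
                 (derivable_pt_lim_exp _)). }
      exact (derivable_pt_lim_mult _ _ _ _ _ H1 (HE s)).
    - cbv beta; ring. }
  destruct (MVT_cor2 _ _ t (t + L) ltac:(lra) (fun s _ => HG s)) as [x [Hx _]].
  rewrite Hper in Hx.
  replace (- kappa * (t + L)) with (- kappa * t + - kappa * L) in Hx by ring.
  rewrite exp_plus in Hx.
  set (Q := exp (- kappa * t)) in *.
  set (P := exp (- kappa * x) * g x * L).
  assert (HP : 0 < P) by (unfold P; repeat apply Rmult_lt_0_compat; auto; apply exp_pos).
  assert (HQ : 0 < Q) by apply exp_pos.
  assert (Hdd : 0 < d * d) by nra.
  (* The extra factor [d] turns the right-hand side into a positive number whatever the sign of [d].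
     Then [d * E t] has the sign of [exp (- kappa * L) - 1], which is opposite to that of
     [kappa]. *)
  assert (Hx' : Q * (exp (- kappa * L) - 1) * (d * E t) = d * d * P).
  { replace (Q * (exp (- kappa * L) - 1) * (d * E t))
      with (d * (Q * exp (- kappa * L) * E t - Q * E t)) by ring.
    rewrite Hx; unfold P; ring. }
  assert (HdP : 0 < d * d * P) by (apply Rmult_lt_0_compat; assumption).
  destruct (Rtotal_order kappa 0) as [Hk|[Hk|Hk]].
  - assert (Hm : 0 < exp (- kappa * L) - 1).
    { rewrite <- exp_0 at 1. apply Rlt_0_minus, exp_increasing; nra. }
    assert (0 < Q * (exp (- kappa * L) - 1)) by (apply Rmult_lt_0_compat; assumption).
    assert (0 < d * E t) by nra. nra.
  (* For [kappa = 0] the function [E] would be both periodic and strictly monotone. *)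
  - subst kappa; rewrite Ropp_0, Rmult_0_l, exp_0 in Hx'; lra.
  - assert (Hm : exp (- kappa * L) - 1 < 0).
    { rewrite <- exp_0 at 1. apply Rlt_minus, exp_increasing; nra. }
    assert (Q * (exp (- kappa * L) - 1) < 0) by nra.
    assert (d * E t < 0) by nra. nra.
Qed.

(** Because the lower off-diagonal entry is the conjugate of [B], the contributions of [B] to the
    derivative of [E = |phi|^2 - |psi|^2] cancel. What is left equals
    [(Re A + Re D) E + (Re A - Re D) g] with [g = |phi|^2 + |psi|^2 > 0], the shape required by
    [periodic_linear_sign]. *)
Lemma linear_system_sign (A D : Cplx) (B phi psi : R -> Cplx) :
  periodic phi -> periodic psi -> (forall t, phi t <> C0 \/ psi t <> C0) ->
  linear_system A D B (fun t => Cconj (B t)) phi psi -> Cre A <> Cre D ->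
  forall t, 0 < (Cre A + Cre D) * (Cre D - Cre A) *
    ((Cre (phi t) * Cre (phi t) + Cim (phi t) * Cim (phi t)) -
     (Cre (psi t) * Cre (psi t) + Cim (psi t) * Cim (psi t))).
Proof.
  intros Hphi Hpsi Hnz Hsys HAD t.
  set (E := fun t => Cre (phi t * Cconj (phi t) - psi t * Cconj (psi t))%K).
  set (g := fun t => (Cre (phi t) * Cre (phi t) + Cim (phi t) * Cim (phi t)) +
                     (Cre (psi t) * Cre (psi t) + Cim (psi t) * Cim (psi t))).
  assert (H := periodic_linear_sign E g (Cre A + Cre D) (Cre A - Cre D) (2 * PI)).
  assert (HE : E t = (Cre (phi t) * Cre (phi t) + Cim (phi t) * Cim (phi t)) -
                     (Cre (psi t) * Cre (psi t) + Cim (psi t) * Cim (psi t)))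
    by (unfold E; cplx; ring).
  rewrite <- HE.
  replace (_ * _) with (- ((Cre A + Cre D) * (Cre A - Cre D) * E t)) by ring.
  apply H.
  - pose proof PI_RGT_0; lra.
  - lra.
  - intros s; unfold g; destruct (Hnz s) as [Hs|Hs]; apply Cnsq_pos in Hs; nra.
  - intros s; unfold E; rewrite Hphi, Hpsi; reflexivity.
  - intros s; destruct (Hsys s) as [H1 H2]; eapply derivable_pt_lim_eq.
    + exact (proj1 (Cderiv_sub _ _ _ _ _
        (Cderiv_mul _ _ _ _ _ H1 (Cderiv_conj _ _ _ H1))
        (Cderiv_mul _ _ _ _ _ H2 (Cderiv_conj _ _ _ H2)))).
    + unfold E, g; cplx; ring.
Qed.

(** The modulus of [Cexp z] is [exp (Cre z)], which is 1 only for [Cre z = 0]. *)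
Lemma Cexp_neq1 (z : Cplx) : Cre z <> 0 -> Cexp z <> C1.
Proof.
  intros Hz H.
  assert (E : exp (Cre z) * exp (Cre z) = 1).
  { transitivity (Cre (Cexp z) * Cre (Cexp z) + Cim (Cexp z) * Cim (Cexp z)).
    - unfold Cexp; simpl. pose proof (sin2_cos2 (Cim z)) as S; unfold Rsqr in S.
      transitivity (exp (Cre z) * exp (Cre z) *
        (sin (Cim z) * sin (Cim z) + cos (Cim z) * cos (Cim z))); [rewrite S|]; ring.
    - rewrite H; cplx; ring. }
  rewrite <- exp_plus, <- exp_0 in E; apply exp_inv in E; lra.
Qed.

(** The sign lemma is used twice. Applied to [(phi, psi)] it determines the sign of a product in [A]
    and [D]; applied to [(p, q)], where the same product occurs, it converts that sign back into
    domination. *)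
Lemma adjoint_dominated_solution (A D : Cplx) (B phi psi : R -> Cplx) :
  Ccont B -> periodic B -> periodic phi -> periodic psi ->
  (forall t, Cnorm (psi t) < Cnorm (phi t)) -> Cre A <> Cre D ->
  linear_system A D B (fun t => Cconj (B t)) phi psi ->
  exists p q, periodic p /\ periodic q /\
    linear_system (- A)%K (- D)%K (fun t => - Cconj (B t))%K (fun t => - B t)%K p q /\
    (forall t, Cnorm (q t) < Cnorm (p t)) /\ forall t, 0 < Cre (phi t * p t)%K.
Proof.
  intros HB HBper Hphi Hpsi Hlt HAD Hsys.
  assert (Hphi0 : forall t, phi t <> C0) by (intros t; eapply Cnorm_lt_neq0, Hlt).
  (* Positivity of this product also excludes [Re A + Re D = 0], so the multiplier
     [exp (2 pi (A + D))] is not 1 and reduction of order is available. *)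
  assert (Hs : 0 < (Cre A + Cre D) * (Cre D - Cre A)).
  { assert (H := linear_system_sign A D B phi psi Hphi Hpsi (fun t => or_introl (Hphi0 t))
                   Hsys HAD 0).
    specialize (Hlt 0); apply Cnorm_lt_iff in Hlt; nra. }
  destruct (adjoint_periodic_solution A D B (fun t => Cconj (B t)) phi psi)
    as [p [q [Hp [Hq [Had Hpair]]]]]; try assumption.
  { apply Cexp_neq1; cplx. pose proof PI_RGT_0. nra. }
  assert (Hlt' : forall t, Cnorm (q t) < Cnorm (p t)).
  { intros t; apply Cnorm_lt_iff.
    assert (H : 0 < (Cre (- A)%K + Cre (- D)%K) * (Cre (- D)%K - Cre (- A)%K) *
      ((Cre (p t) * Cre (p t) + Cim (p t) * Cim (p t)) -
       (Cre (q t) * Cre (q t) + Cim (q t) * Cim (q t)))).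
    { apply (linear_system_sign _ _ (fun t => - Cconj (B t))%K p q Hp Hq).
      (* The normalisation [phi p + psi q = 1] prevents [p] and [q] from vanishing together. *)
      - intros s; destruct (Req_dec (Cre (p s) * Cre (p s) + Cim (p s) * Cim (p s)) 0) as [H0|H0].
        + right; intros H1; specialize (Hpair s); rewrite H1 in Hpair.
          assert (Hp0 : p s = C0) by (apply Cplx_eq; cplx; nra).
          rewrite Hp0 in Hpair; injection Hpair; cplx; lra.
        + left; intros H1; apply H0; rewrite H1; cplx; ring.
      - intros s; destruct (Had s) as [H1 H2]; split; [exact H1|].
        eapply Cderiv_eq; [exact H2|]; autorewrite with conj; reflexivity.
      - cplx; lra. }
    cplx; nra. }
  exists p, q; repeat split; try assumption; try apply Had.
  intros t; specialize (Hpair t); specialize (Hlt t); specialize (Hlt' t).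
  (* [|phi p| > |psi q| = |1 - phi p|] puts [phi p] in the half plane [Re > 1/2]. *)
  apply Cnorm_lt_iff in Hlt; apply Cnorm_lt_iff in Hlt'.
  set (z := (phi t * p t)%K) in *.
  assert (E : (psi t * q t)%K = (C1 - z)%K) by (rewrite <- Hpair; ring).
  assert (Hn : forall u v : Cplx, Cre (u * v)%K * Cre (u * v)%K + Cim (u * v)%K * Cim (u * v)%K
    = (Cre u * Cre u + Cim u * Cim u) * (Cre v * Cre v + Cim v * Cim v))
    by (intros; cplx; ring).
  assert (H : Cre (psi t * q t)%K * Cre (psi t * q t)%K + Cim (psi t * q t)%K * Cim (psi t * q t)%K
              < Cre z * Cre z + Cim z * Cim z).
  { unfold z; rewrite !Hn.
    apply Rmult_le_0_lt_compat; try assumption; nra. }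
  rewrite E in H; clearbody z; cplx; nra.
Qed.

(** The pair [(f, conj f)] solves the system with [D = conj A], whose trace is [2 Re A]. Its
    multiplier [exp (4 pi Re A)] equals 1 only for [Re A = 0], and this case has an explicit
    solution. The last conclusion is the form in which [winding_opp] reads off the winding
    number. *)
Lemma adjoint_real_solution (A : Cplx) (B f : R -> Cplx) :
  Ccont B -> periodic B -> periodic f -> (forall t, f t <> C0) ->
  (forall t, Cderiv_lim f t (A * f t + B t * Cconj (f t))%K) ->
  exists (g : R -> Cplx) (m : Cplx), periodic g /\
    (forall t, Cderiv_lim g t (- A * g t - Cconj (B t) * Cconj (g t))%K) /\
    forall t, 0 < Cre (m * (f t * g t))%K.
Proof.
  intros HB HBper Hf Hf0 Hd.
  destruct (Req_dec (Cre A) 0) as [HA|HA].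
  (* Here [conj A = - A], so conjugating the equation of [f] and multiplying by [i] gives the dual
     equation. The constant [- i] makes [m f g] equal to [|f|^2]. *)
  - exists (fun t => Ci * Cconj (f t))%K, (- Ci)%K; repeat split.
    + intros t; rewrite Hf; reflexivity.
    + eapply (fun P Q => proj1 (Cderiv_eq _ _ _ _ P Q)).
      * exact (Cderiv_scal Ci _ _ _ (Cderiv_conj _ _ _ (Hd t))).
      * apply Cplx_eq; cplx; rewrite HA; ring.
    + eapply (fun P Q => proj2 (Cderiv_eq _ _ _ _ P Q)).
      * exact (Cderiv_scal Ci _ _ _ (Cderiv_conj _ _ _ (Hd t))).
      * apply Cplx_eq; cplx; rewrite HA; ring.
    + intros t; pose proof (Cnsq_pos _ (Hf0 t)); cplx; nra.
  - destruct (adjoint_periodic_solution A (Cconj A) B (fun t => Cconj (B t)) f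
                (fun t => Cconj (f t))) as [p [q [Hp [Hq [Had Hpair]]]]]; try assumption.
    + intros t; rewrite Hf; reflexivity.
    + intros t; split; [apply Hd|].
      eapply Cderiv_eq; [exact (Cderiv_conj _ _ _ (Hd t))|].
      autorewrite with conj; ring.
    + apply Cexp_neq1; cplx; pose proof PI_RGT_0; nra.
    (* Conjugating the [q] equation lets it be added to the [p] equation. Since [conj f * q] and
       [f * conj q] have the same real part, the real part of [f g] is that of
       [f p + conj f * q = 1]. *)
    + exists (fun t => p t + Cconj (q t))%K, C1; split; [|split].
      * intros t; rewrite Hp, Hq; reflexivity.
      * intros t; destruct (Had t) as [H1 H2].
        eapply Cderiv_eq; [exact (Cderiv_add _ _ _ _ _ H1 (Cderiv_conj _ _ _ H2))|].
        autorewrite with conj; ring.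
      * intros t; assert (E : Cre (f t * p t + Cconj (f t) * q t)%K = 1)
          by (rewrite Hpair; reflexivity).
        cplx; nra.
Qed.

(** * Polar form and winding numbers *)

Definition Cunit (theta : R) : Cplx := (cos theta, sin theta).

Lemma Cunit_add (x y : R) : Cunit (x + y) = (Cunit x * Cunit y)%K.
Proof. apply Cplx_eq; unfold Cunit; cplx; [rewrite cos_plus | rewrite sin_plus]; ring. Qed.

Lemma Cnorm_polar (rho theta : R) : 0 <= rho -> Cnorm (RtoC rho * Cunit theta)%K = rho.
Proof.
  intros H; unfold Cnorm, Cunit; cplx.
  pose proof (sin2_cos2 theta) as S; unfold Rsqr in S.
  replace (_ + _) with (rho * rho * (sin theta * sin theta + cos theta * cos theta)) by ring.
  rewrite S, Rmult_1_r; apply sqrt_square, H.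
Qed.

Lemma polar_atan (z : Cplx) :
  0 < Cre z -> z = (RtoC (Cnorm z) * Cunit (atan (Cim z / Cre z)))%K.
Proof.
  intros H; destruct z as [x y]; simpl in H.
  set (S := sqrt (1 + (y / x)²)).
  assert (HS : 0 < S) by (apply sqrt_lt_R0; unfold Rsqr; nra).
  assert (E : Cnorm (x, y) = x * S).
  { unfold Cnorm, S; simpl.
    rewrite <- (sqrt_square x) at 3 by lra.
    rewrite <- sqrt_mult by (unfold Rsqr; nra).
    f_equal; unfold Rsqr; field; lra. }
  rewrite E; apply Cplx_eq; unfold Cunit; cplx; [rewrite cos_atan | rewrite sin_atan];
    fold S; field; lra.
Qed.

Lemma polar_form (z : Cplx) : exists theta, z = (RtoC (Cnorm z) * Cunit theta)%K.
Proof.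
  destruct (Rtotal_order (Cre z) 0) as [H|[H|H]].
  - exists (atan (Cim (- z)%K / Cre (- z)%K) + PI).
    assert (E : (- z)%K = (RtoC (Cnorm (- z)%K) * Cunit (atan (Cim (- z)%K / Cre (- z)%K)))%K)
      by (apply polar_atan; cplx; lra).
    assert (N : Cnorm (- z)%K = Cnorm z) by (unfold Cnorm; cplx; f_equal; ring).
    rewrite N in E; rewrite Cunit_add.
    replace (Cunit PI) with (- C1)%K
      by (apply Cplx_eq; unfold Cunit; cplx; [rewrite cos_PI | rewrite sin_PI]; ring).
    transitivity (- (- z))%K; [ring|]. rewrite E at 1; ring.
  - assert (N : Cnorm z = Rabs (Cim z)).
    { unfold Cnorm; rewrite H, <- sqrt_Rsqr_abs; f_equal; unfold Rsqr; ring. }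
    rewrite N; destruct (Rle_dec 0 (Cim z)) as [L|L].
    + exists (PI / 2); rewrite Rabs_pos_eq by exact L.
      apply Cplx_eq; unfold Cunit; cplx; rewrite cos_PI2, sin_PI2; lra.
    + exists (- (PI / 2)); rewrite Rabs_left by lra.
      apply Cplx_eq; unfold Cunit; cplx; rewrite cos_neg, sin_neg, cos_PI2, sin_PI2; lra.
  - eexists; apply polar_atan, H.
Qed.

(** The product [m f g] stays in the right half plane, so its argument can be taken as an [atan],
    which is continuous and returns to its value after a period. Up to the constant argument [mu] of
    [m], an argument of [g] is this one minus [theta], so its increment is the opposite of that of
    [theta]. *)
Lemma winding_opp (f g : R -> Cplx) (m : Cplx) (k : Z) :
  winding f k -> Ccont g -> periodic g -> (forall t, 0 < Cre (m * (f t * g t))%K) ->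
  winding g (- k)%Z.
Proof.
  intros [Hf [Hfper [Hf0 [theta [Hth [Hpol Hk]]]]]] Hg Hgper Hpos.
  pose (zeta := fun t => (m * (f t * g t))%K).
  assert (Hz : Ccont zeta)
    by (apply (Ccont_mul (fun _ => m) _ (Ccont_const m)), Ccont_mul; assumption).
  assert (Hm0 : m <> C0).
  { intros E; specialize (Hpos 0); rewrite E in Hpos; cplx; lra. }
  assert (Hg0 : forall t, g t <> C0).
  { intros t E; specialize (Hpos t); rewrite E in Hpos; cplx; lra. }
  destruct (polar_form m) as [mu Hmu].
  repeat split; try apply Hg; try assumption.
  exists (fun t => atan (Cim (zeta t) / Cre (zeta t)) - theta t - mu); repeat split.
  - intros t; apply continuity_pt_minus; [apply continuity_pt_minus|].
    + apply (continuity_pt_comp (fun t => Cim (zeta t) / Cre (zeta t)) atan).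
      * apply (continuity_pt_div (fun t => Cim (zeta t)) (fun t => Cre (zeta t))).
        -- apply Hz.
        -- apply Hz.
        -- apply Rgt_not_eq, Hpos.
      * apply derivable_continuous_pt, derivable_pt_atan.
    + apply Hth.
    + apply continuity_pt_const; intros x y; reflexivity.
  - intros t.
    set (al := atan _).
    assert (Ez : zeta t = (RtoC (Cnorm (zeta t)) * Cunit al)%K) by apply polar_atan, Hpos.
    assert (Ef : f t = (RtoC (Cnorm (f t)) * Cunit (theta t))%K).
    { rewrite Hpol at 1; apply Cplx_eq; unfold Cunit; cplx; ring. }
    pose proof (Cnorm_pos _ Hm0) as Pm; pose proof (Cnorm_pos _ (Hf0 t)) as Pf.
    (* The modulus of [g t], written through those of [zeta t], [m] and [f t]; [Cnorm_polar]
       recognises it as such afterwards. *)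
    set (rho := Cnorm (zeta t) / (Cnorm m * Cnorm (f t))).
    assert (Hrho : 0 <= rho).
    { apply Rmult_le_pos; [apply sqrt_pos|].
      apply Rlt_le, Rinv_0_lt_compat, Rmult_lt_0_compat; assumption. }
    assert (Eg : g t = (RtoC rho * Cunit (al - theta t - mu))%K).
    { transitivity (zeta t / (m * f t))%K; [unfold zeta; field; split; auto|].
      transitivity (((m * f t) * (RtoC rho * Cunit (al - theta t - mu))) / (m * f t))%K;
        [|field; split; auto].
      f_equal; rewrite Ez, Hmu, Ef at 1.
      replace (Cunit al) with (Cunit (mu + (theta t + (al - theta t - mu)))) by (f_equal; ring).
      rewrite !Cunit_add.
      replace (RtoC (Cnorm (zeta t))) with (RtoC (Cnorm m) * (RtoC (Cnorm (f t)) * RtoC rho))%K.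
      - ring.
      - apply Cplx_eq; unfold rho; cplx; field; lra. }
    rewrite Eg, Cnorm_polar by exact Hrho.
    apply Cplx_eq; unfold Cunit; cplx; ring.
  - assert (Ez : zeta (2 * PI) = zeta 0).
    { unfold zeta; rewrite <- (Rplus_0_l (2 * PI)), Hfper, Hgper; reflexivity. }
    rewrite Ez, opp_IZR; lra.
Qed.

(** * From the partial differential equations to equations for the coefficients *)

Lemma Cderiv_ext_pos (f g : R -> Cplx) (r : R) (l : Cplx) :
  0 < r -> (forall x, 0 < x -> f x = g x) -> Cderiv_lim f r l -> Cderiv_lim g r l.
Proof.
  intros Hr E [H1 H2].
  assert (L : locally r (fun x => f x = g x)).
  { exists (mkposreal r Hr); intros y Hy; apply E.
    apply Rabs_lt_between' in Hy; simpl in Hy; lra. }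
  split; apply is_derive_Reals.
  - apply (is_derive_ext_loc (fun y => Cre (f y))); [|apply is_derive_Reals, H1].
    revert L; apply filter_imp; intros x ->; reflexivity.
  - apply (is_derive_ext_loc (fun y => Cim (f y))); [|apply is_derive_Reals, H2].
    revert L; apply filter_imp; intros x ->; reflexivity.
Qed.

Lemma solves_L_ext (a b nu : R) (c : R -> Cplx) (eps : R) (w w' : R -> R -> Cplx) :
  (forall r t, 0 < r -> w r t = w' r t) ->
  solves_L a b nu c eps w -> solves_L a b nu c eps w'.
Proof.
  intros E H r t Hr; destruct (H r t Hr) as [wr [wt [[H1 H2] H3]]].
  exists wr, wt; rewrite <- (E r t Hr); split; [split|exact H3].
  - revert H1; apply Cderiv_ext_pos; [exact Hr|]; intros x Hx; apply E, Hx.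
  - revert H2; apply Cderiv_ext; intros y; apply E, Hr.
Qed.

Definition basic (s : Cplx) (phi psi : R -> Cplx) (r t : R) : Cplx :=
  (Cpow r s * phi t + Cconj (Cpow r s * psi t))%K.

Lemma basic_deriv_r (s : Cplx) (phi psi : R -> Cplx) (r t : R) :
  0 < r -> Cderiv_lim (fun x => basic s phi psi x t) r
    (RtoC (/ r) * (s * Cpow r s * phi t + Cconj (s * Cpow r s * psi t)))%K.
Proof.
  intros Hr; pose proof (Cderiv_Cpow s r Hr) as H.
  eapply Cderiv_eq.
  - exact (Cderiv_add _ _ _ _ _ (Cderiv_mul _ _ _ _ _ H (Cderiv_const (phi t) r))
      (Cderiv_conj _ _ _ (Cderiv_mul _ _ _ _ _ H (Cderiv_const (psi t) r)))).
  - cbv beta; autorewrite with conj; ring.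
Qed.

Lemma basic_deriv_t (s : Cplx) (phi psi : R -> Cplx) (r t : R) (l m : Cplx) :
  Cderiv_lim phi t l -> Cderiv_lim psi t m ->
  Cderiv_lim (fun x => basic s phi psi r x) t (basic s (fun _ => l) (fun _ => m) r t).
Proof.
  intros H1 H2.
  exact (Cderiv_add _ _ _ _ _ (Cderiv_scal _ _ _ _ H1)
           (Cderiv_conj _ _ _ (Cderiv_scal _ _ _ _ H2))).
Qed.

Lemma Cmul_RtoC_inv (r : R) (z : Cplx) : 0 < r -> (RtoC r * (RtoC (/ r) * z))%K = z.
Proof. intros Hr; apply Cplx_eq; cplx; field; lra. Qed.

(** Uniqueness of derivatives identifies the radial partial derivative with the computed one, and
    the equation is then solved for the angular one. Only [w] is known to be differentiable in [t]
    at this point, so the result concerns [basic s phi psi] and not yet [phi] and [psi]. *)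
Lemma solves_L_basic (a b nu : R) (c : R -> Cplx) (eps : R) (s : Cplx) (phi psi : R -> Cplx)
  (r t : R) :
  solves_L a b nu c eps (basic s phi psi) -> 0 < r -> lam a b eps <> C0 ->
  Cderiv_lim (fun x => basic s phi psi r x) t
    ((Ci * (s * Cpow r s * phi t + Cconj (s * Cpow r s * psi t))
      + c t * Cconj (basic s phi psi r t)) / lam a b eps
     - Ci * RtoC nu * basic s phi psi r t)%K.
Proof.
  intros H Hr Hl; destruct (H r t Hr) as [wr [wt [[H1 H2] H3]]].
  rewrite (Cderiv_unique _ _ _ _ H1 (basic_deriv_r s phi psi r t Hr)) in H3.
  rewrite Cmul_RtoC_inv in H3 by exact Hr.
  eapply Cderiv_eq; [exact H2|].
  match type of H3 with ?e = _ => transitivity (wt - e / lam a b eps)%K end.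
  - rewrite H3; field; exact Hl.
  - field; exact Hl.
Qed.

Lemma solves_Lstar_basic (a b nu : R) (c : R -> Cplx) (eps : R) (s : Cplx)
  (X Z X' Z' : R -> Cplx) :
  (forall t, Cderiv_lim X t (X' t)) -> (forall t, Cderiv_lim Z t (Z' t)) ->
  (forall r t, 0 < r ->
     (lam a b eps * basic s X' Z' r t - Ci * (s * Cpow r s * X t + Cconj (s * Cpow r s * Z t))
      - Ci * lam a b eps * RtoC nu * basic s X Z r t
      + Cconj (c t) * Cconj (basic s X Z r t) = C0)%K) ->
  solves_Lstar a b nu c eps (basic s X Z).
Proof.
  intros HX HZ H r t Hr.
  exists (RtoC (/ r) * (s * Cpow r s * X t + Cconj (s * Cpow r s * Z t)))%K, (basic s X' Z' r t).
  split.
  - split; [apply basic_deriv_r, Hr | apply (basic_deriv_t s X Z r t (X' t) (Z' t)); auto].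
  - rewrite Cmul_RtoC_inv by exact Hr.
    transitivity (- C0)%K; [|ring]; f_equal.
    rewrite <- (H r t Hr); ring.
Qed.

(* At [r = exp (pi / (2 Im s))] the factor [r^s] is purely imaginary, so this value of [r]
   together with [r = 1] separates [phi] from [psi]. *)
Lemma Cpow_imaginary (s : Cplx) :
  Cim s <> 0 -> exists r, 0 < r /\ Cpow r s <> C0 /\ Cconj (Cpow r s) = (- Cpow r s)%K.
Proof.
  intros Hs; exists (exp (PI / 2 / Cim s)); repeat split; [apply exp_pos | apply Cexp_neq0 |].
  unfold Cpow, Cexp; apply Cplx_eq; cplx; [|ring].
  rewrite ln_exp.
  replace (Cre s * 0 + Cim s * (PI / 2 / Cim s)) with (PI / 2) by (field; exact Hs).
  rewrite cos_PI2; ring.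
Qed.

Lemma C2_neq0 : (C1 + C1)%K <> C0.
Proof. intros H; injection H; lra. Qed.

(** [phi] and [psi] are recovered as fixed combinations of [w] at two radii, from which they inherit
    both differentiability and their equations. *)
Lemma basic_solution_system (a b nu : R) (c : R -> Cplx) (eps : R) (s : Cplx)
  (phi psi : R -> Cplx) :
  Cim s <> 0 -> lam a b eps <> C0 -> solves_L a b nu c eps (basic s phi psi) ->
  linear_system (Ci * (s / lam a b eps - RtoC nu))%K
    (- (Ci * (s / Cconj (lam a b eps) - RtoC nu)))%K
    (fun t => c t / lam a b eps)%K (fun t => Cconj (c t / lam a b eps))%K phi psi.
Proof.
  intros Hs Hl Hsol t.
  pose proof (Cconj_neq0 _ Hl) as Hlc.
  destruct (Cpow_imaginary s Hs) as [r [Hr [Hp0 Hpc]]].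
  assert (H1 := solves_L_basic a b nu c eps s phi psi 1 t Hsol Rlt_0_1 Hl).
  assert (H2 := solves_L_basic a b nu c eps s phi psi r t Hsol Hr Hl).
  set (l := lam a b eps) in *; set (P := Cpow r s) in *.
  set (h := Cinv (C1 + C1)%K).
  assert (Hh : Cconj h = h) by (apply Cplx_eq; unfold h, Cinv; cplx; field).
  pose proof C2_neq0 as H20.
  assert (HnP : (- P)%K <> C0) by (rewrite <- Hpc; apply Cconj_neq0, Hp0).
  pose (w1 := fun t => basic s phi psi 1 t); pose (w2 := fun t => basic s phi psi r t).
  (* With [P] purely imaginary, [w1 = phi + conj psi] and [w2 / P = phi - conj psi]; half the sum
     gives [phi], and half the difference gives [conj psi]. *)
  assert (Ephi : forall t, (h * (w1 t + Cinv P * w2 t))%K = phi t).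
  { intros x; unfold w1, w2, basic; fold P; rewrite Cpow_1; autorewrite with conj; rewrite Hpc.
    replace (Cconj C1) with C1 by (apply Cplx_eq; cplx; ring).
    unfold h; field; repeat split; assumption. }
  assert (Epsi : forall t, Cconj (h * (w1 t - Cinv P * w2 t))%K = psi t).
  { intros x; unfold w1, w2, basic; fold P; rewrite Cpow_1; autorewrite with conj.
    rewrite Cconj_inv, Hpc, Hh.
    replace (Cconj C1) with C1 by (apply Cplx_eq; cplx; ring).
    unfold h; field; repeat split; assumption. }
  split.
  - apply (Cderiv_ext _ _ _ _ Ephi).
    eapply Cderiv_eq;
      [exact (Cderiv_scal _ _ _ _ (Cderiv_add _ _ _ _ _ H1 (Cderiv_scal (Cinv P) _ _ _ H2)))|].
    unfold basic; fold P; rewrite Cpow_1; autorewrite with conj; rewrite Hpc.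
    replace (Cconj C1) with C1 by (apply Cplx_eq; cplx; ring).
    unfold h; field; repeat split; assumption.
  - apply (Cderiv_ext _ _ _ _ Epsi).
    eapply Cderiv_eq;
      [exact (Cderiv_conj _ _ _
        (Cderiv_scal _ _ _ _ (Cderiv_sub _ _ _ _ _ H1 (Cderiv_scal (Cinv P) _ _ _ H2))))|].
    unfold basic; fold P; rewrite Cpow_1; autorewrite with conj.
    rewrite Cconj_inv, Hpc, Hh.
    replace (Cconj C1) with C1 by (apply Cplx_eq; cplx; ring).
    unfold h; field; repeat split; assumption.
Qed.

(** * Construction of the basic solution of the adjoint operator *)

Lemma Cn_real_continuity (n : nat) (f : R -> R) : Cn_real n f -> continuity f.
Proof.
  destruct n as [|n]; simpl; [auto|].
  intros [f' [H _]] x; apply derivable_continuous_pt; exists (f' x); apply H.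
Qed.

Lemma linear_system_cont (A D : Cplx) (B C phi psi : R -> Cplx) :
  linear_system A D B C phi psi -> Ccont phi.
Proof. intros H; eapply Cderiv_cont; intros t; apply H. Qed.

Lemma basic_sol_Lstar_basic (a b nu : R) (c : R -> Cplx) (eps : R) (s : Cplx)
  (X Z : R -> Cplx) :
  periodic X -> periodic Z -> (forall t, Cnorm (Z t) < Cnorm (X t)) ->
  solves_Lstar a b nu c eps (basic s X Z) -> basic_sol_Lstar a b nu c eps (basic s X Z).
Proof.
  intros HX HZ Hlt H; split; [|split; [exact H|]].
  (* At [r = 1] the value is [X + conj Z], which cannot vanish because [|Z| < |X|]. *)
  - exists 1, 0; split; [lra|]; unfold basic; rewrite Cpow_1; intros E.
    specialize (Hlt 0); apply Cnorm_lt_iff in Hlt.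
    injection E; intros E2 E1; cplx; nra.
  - exists s, X, Z; repeat split; assumption.
Qed.

Theorem theorem2p2
  (a b nu : R) (k : nat) (c : R -> Cplx)
  (ha : 0 < a) (hb : b <> 0) (hnu0 : 0 <= nu) (hnu1 : nu < 1) (hk : (2 <= k)%nat)
  (hcper : periodic c) (hcreg : Cn_cplx k c)
  (sigma : R -> Cplx) (phi psi : R -> R -> Cplx) (j : Z)
  (hsig : Ccont_fun sigma) (hphi : Ccont2 phi) (hpsi : Ccont2 psi)
  (hbasic : forall eps,
     basic_sol_L a b nu c eps
       (fun r t => Cadd (Cmul (Cpow r (sigma eps)) (phi t eps))
                        (Cconj (Cmul (Cpow r (sigma eps)) (psi t eps)))))
  (hchar : forall eps,
     has_char
       (fun r t => Cadd (Cmul (Cpow r (sigma eps)) (phi t eps))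
                        (Cconj (Cmul (Cpow r (sigma eps)) (psi t eps))))
       (sigma eps) j) :
  forall eps, exists X Z : R -> Cplx,
    let ws := fun r t => Cadd (Cmul (Cpow r (Copp (sigma eps))) (X t))
                              (Cconj (Cmul (Cpow r (Copp (sigma eps))) (Z t))) in
    periodic X /\ periodic Z /\
    basic_sol_Lstar a b nu c eps ws /\
    (forall t, Cnorm (Z t) < Cnorm (X t)) /\
    has_char ws (Copp (sigma eps)) (- j)%Z.
Proof.
  intros eps.
  set (l := lam a b eps); set (s := sigma eps).
  assert (Hl : l <> C0) by (intros E; injection E; lra).
  pose proof (Cconj_neq0 _ Hl) as Hlc.
  assert (HB : Ccont (fun t => c t / l)%K).
  { apply Ccont_mul; [|apply Ccont_const].
    split; eapply Cn_real_continuity; apply hcreg. }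
  assert (HBper : periodic (fun t => c t / l)%K) by (intros t; rewrite hcper; reflexivity).
  destruct (hbasic eps) as [_ [Hsol _]].
  destruct (hchar eps) as [[Hs [phi1 [psi1 [[Hphi [Hpsi Hform]] [Hlt Hw]]]]]
                          |[Hs [f [Hf [Hf0 [Hform Hw]]]]]]; fold s in Hs, Hform, Hsol.
  (* The dominated pair [(phi1, psi1)] provided by the characteristic represents the same function
     as the given pair for positive radii, so the equation transfers to it. *)
  - apply (solves_L_ext _ _ _ _ _ _ (basic s phi1 psi1) Hform) in Hsol.
    assert (Hsys := basic_solution_system a b nu c eps s phi1 psi1 Hs Hl Hsol).
    fold l in Hsys.
    set (A := (Ci * (s / l - RtoC nu))%K) in *.
    set (D := (- (Ci * (s / Cconj l - RtoC nu)))%K) in *.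
    (* The difference is minus the imaginary part of [s (1 / l + 1 / conj l)], and the bracket is
       the positive real [2 a / |l|^2]; it is nonzero because [s] is not real. *)
    assert (HAD : Cre A <> Cre D).
    { assert (Hn : 0 < a * a + b * eps * (b * eps)) by nra.
      assert (E : Cre A - Cre D = - 2 * a * Cim s / (a * a + b * eps * (b * eps)))
        by (unfold A, D, l, lam, Cinv; cplx; unfold Cinv; cplx; field; nra).
      intros E'; rewrite E', Rminus_diag in E.
      symmetry in E; apply (Rmult_eq_compat_r (a * a + b * eps * (b * eps))) in E.
      unfold Rdiv in E; rewrite Rmult_assoc, Rinv_l in E by lra; nra. }
    destruct (adjoint_dominated_solution A D (fun t => c t / l)%K phi1 psi1)
      as [p [q [Hp [Hq [Had [Hpq Hpos]]]]]]; try assumption.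
    (* The factor [l / conj l] converts the dual system into the adjoint equation. It has modulus 1,
       so domination by [p] is preserved. *)
    pose (Z := fun t => (l / Cconj l * q t)%K).
    assert (HZper : periodic Z) by (intros t; unfold Z; rewrite Hq; reflexivity).
    assert (HZ : forall t, Cnorm (Z t) < Cnorm (p t)).
    { intros t; replace (Cnorm (Z t)) with (Cnorm (q t)); [apply Hpq|].
      assert (Hn : 0 < a * a + b * eps * (b * eps)) by nra.
      unfold Cnorm; f_equal; unfold Z, l, lam, Cinv; cplx; unfold Cinv; cplx; field; nra. }
    exists p, Z; refine (conj Hp (conj HZper (conj _ (conj HZ _)))).
    + apply (basic_sol_Lstar_basic a b nu c eps (- s)%K p Z Hp HZper HZ).
      apply (solves_Lstar_basic _ _ _ _ _ _ _ _
               (fun t => - A * p t + - Cconj (c t / l) * q t)%K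
               (fun t => l / Cconj l * (- (c t / l) * p t + - D * q t))%K).
      * intros t; apply Had.
      * intros t; apply Cderiv_scal, Had.
      * intros r t _; fold l; unfold basic, Z, A, D; autorewrite with conj.
        field; split; assumption.
    + left; split; [cplx; lra|].
      exists p, Z; split; [repeat split; assumption | split; [exact HZ|]].
      apply (winding_opp phi1 p C1 j Hw (linear_system_cont _ _ _ _ _ _ Had) Hp).
      intros t; specialize (Hpos t); cplx; lra.
  (* For a real exponent, [r^s f] is treated as a basic form with second coefficient zero. At
     [r = 1] it is [f] itself, which yields the equation of [f]. *)
  - apply (solves_L_ext _ _ _ _ _ _ (basic s f (fun _ => C0))) in Hsol.
    2:{ intros r t Hr; rewrite (Hform r t Hr); unfold basic; autorewrite with conj; ring. }
    destruct (adjoint_real_solution (Ci * (s / l - RtoC nu))%K (fun t => c t / l)%K f)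
      as [g [m [Hg [Hgd Hpos]]]]; try assumption.
    { intros t; apply (Cderiv_ext (fun x => basic s f (fun _ => C0) 1 x)).
      - intros x; unfold basic; rewrite Cpow_1; autorewrite with conj; ring.
      - eapply Cderiv_eq; [exact (solves_L_basic a b nu c eps s _ _ 1 t Hsol Rlt_0_1 Hl)|].
        fold l; unfold basic; rewrite Cpow_1; autorewrite with conj.
        replace (Cconj C1) with C1 by (apply Cplx_eq; cplx; ring).
        field; exact Hl. }
    (* Since [conj X = l * conj g], this factor changes the coefficient [conj c / conj l] of the
       dual equation into the [conj c / l] of the adjoint equation. *)
    pose (X := fun t => (Cconj l * g t)%K).
    assert (HXper : periodic X) by (intros t; unfold X; rewrite Hg; reflexivity).
    assert (HX0 : forall t, X t <> C0).
    { intros t; apply Cmul_neq0; [exact Hlc|].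
      intros E; specialize (Hpos t); rewrite E in Hpos; cplx; lra. }
    assert (HXd : forall t, Cderiv_lim X t (Cconj l * (- (Ci * (s / l - RtoC nu)) * g t
                              - Cconj (c t / l) * Cconj (g t)))%K)
      by (intros t; apply Cderiv_scal, Hgd).
    assert (H0 : periodic (fun _ => C0)) by (intros t; reflexivity).
    assert (HZ : forall t, Cnorm C0 < Cnorm (X t)) by (intros t; apply Cnorm_C0_lt, HX0).
    exists X, (fun _ => C0); refine (conj HXper (conj H0 (conj _ (conj HZ _)))).
    + apply (basic_sol_Lstar_basic a b nu c eps (- s)%K X (fun _ => C0) HXper H0 HZ).
      apply (solves_Lstar_basic _ _ _ _ _ _ _ _ _ (fun _ => C0) HXd).
      * intros t; apply Cderiv_const.
      * intros r t _; fold l; unfold basic, X; autorewrite with conj.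
        rewrite Cpow_real by (cplx; lra).
        field; split; assumption.
    + right; split; [cplx; lra|].
      exists X; refine (conj HXper (conj HX0 (conj _ _))).
      * intros r t _; autorewrite with conj; ring.
      (* Dividing [m] by [conj l] compensates the factor in [X], so the product is the [m f g]
         already known to have positive real part. *)
      * apply (winding_opp f X (m / Cconj l)%K j Hw (Cderiv_cont _ _ HXd) HXper).
        intros t; replace (_ * _)%K with (m * (f t * g t))%K; [apply Hpos|].
        unfold X; field; exact Hlc.
Qed.
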